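(* Let $F$ be a field of characteristic $2$. Let $\phi$ be an anisotropic quasilinear quadratic form of dimension $>1$ over $F$, and write $\dim\phi = 2^n+m$ for uniquely determined integers $n\geq 0$ and $m\in[1,2^n]$. Then either $i_1(\phi)=m$ or $i_1(\phi)\leq \frac{m}{2}$.
   Context: Let $F$ be a field of characteristic $2$. A quasilinear quadratic form over $F$ is a quadratic form $\phi\colon V_\phi\to F$ on a finite-dimensional $F$-vector space with $\phi(v+w)=\phi(v)+\phi(w)$ for all $v,w$ (equivalently, in a basis, $\phi=a_1X_1^2+\dots+a_nX_n^2$ with $a_i\in F$). It is isotropic if $\phi(v)=0$ for some $v\neq0$, anisotropic otherwise. The set of $v$ with $\phi(v)=0$ is a subspace whose dimension is denoted $i_0(\phi)$ (the defect index). For a field extension $L/F$, $\phi_L$ denotes extension of scalars. If $\phi$ is anisotropic of dimension $>1$, the projective scheme $X_\phi=\{\phi=0\}\subset\mathbb P(V_\phi)$ is integral; $F(\phi)$ denotes its function field, and $i_1(\phi):=i_0(\phi_{F(\phi)})$. *)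

(* Defs.v *)
From HB Require Import structures.
From mathcomp Require Import all_boot all_order all_algebra.
From mathcomp Require Import mpoly.
From mathcomp Require Import ring.
From Stdlib Require Import ClassicalEpsilon.

Set Implicit Arguments.
Unset Strict Implicit.
Unset Printing Implicit Defensive.

Import GRing.Theory.
Local Open Scope ring_scope.

Definition polar (F : fieldType) (V : lmodType F) (q : V -> F) (v w : V) : F :=
  q (v + w) - q v - q w.

(* [polar] is symmetric, so linearity in one argument is bilinearity. *)
Definition quadratic (F : fieldType) (V : lmodType F) (q : V -> F) : Prop :=
  (forall a v, q (a *: v) = a ^+ 2 * q v) /\
  (forall w, scalar (polar q ^~ w)).

Record qlform (F : fieldType) (V : vectType F) := QLForm {
  qlval :> V -> F;
  qlform_quadratic : quadratic qlval;
  qlformD : forall v w, qlval (v + w) = qlval v + qlval w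
}.

Definition isotropic (F : fieldType) (V : vectType F) (phi : qlform V) : Prop :=
  exists2 v : V, v != 0 & phi v = 0.

Definition anisotropic (F : fieldType) (V : vectType F) (phi : qlform V) : Prop :=
  ~ isotropic phi.

Section DefectIndex.
Variables (F : fieldType) (V : vectType F) (phi : qlform V).

Lemma qlformZ a v : phi (a *: v) = a ^+ 2 * phi v.
Proof. by have [-> _] := qlform_quadratic phi. Qed.

Lemma qlform0 : phi 0 = 0.
Proof. by rewrite -(scale0r 0) qlformZ expr0n mul0r. Qed.

Lemma defect_space_subproof :
  exists U : {vspace V}, forall v, (v \in U) = (phi v == 0).
Proof.
suff H k (U : {vspace V}) : (\dim {:V} - \dim U <= k)%N ->
    (forall v, v \in U -> phi v = 0) ->
    exists U' : {vspace V}, forall v, (v \in U') = (phi v == 0).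
  apply: (H (\dim {:V}) 0%VS); first exact: leq_subr.
  by move=> v; rewrite memv0 => /eqP ->; exact: qlform0.
elim: k U => [|k IHk] U hU U0;
  have [[v [v0 vU]]|nv] := classic (exists v, phi v = 0 /\ v \notin U);
  try (exists U => v; apply/idP/eqP; [exact: U0 | move=> v0;
       apply: contraT => vU; case: nv; by exists v]).
- move: hU; rewrite leqn0 subn_eq0 => hU.
  have /eqP E : U == {:V}%VS by rewrite eqEdim subvf hU.
  by move: vU; rewrite E memvf.
- apply: (IHk (U + <[v]>)%VS).
    have lt : (\dim U < \dim (U + <[v]>))%N.
      rewrite (ltn_leqif (dimv_leqif_sup (addvSl U <[v]>))).
      by rewrite subv_add subvv -memvE.
    have le : (\dim (U + <[v]>) <= \dim {:V})%N by apply/dimvS/subvf.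
    by move: hU; rewrite !leq_subLR => hU; apply: leq_trans hU _; rewrite addnS -addSn leq_add2r.
  move=> _ /memv_addP[u uU [_ /vlineP[a ->] ->]].
  by rewrite qlformD qlformZ U0 // v0 mulr0 addr0.
Qed.

(* The subspace of all vectors on which phi vanishes. *)
Definition defect_space : {vspace V} :=
  sval (constructive_indefinite_description _ defect_space_subproof).

Lemma mem_defect_space v : (v \in defect_space) = (phi v == 0).
Proof. by rewrite /defect_space; case: constructive_indefinite_description => U /= ->. Qed.

Definition defect_index : nat := \dim defect_space.

End DefectIndex.

Section BaseChange.
Variables (F : fieldType) (V : vectType F) (phi : qlform V).

(* sum_i phi(e_i) X_i^2 at a point with coordinates in a commutative           *)
(* F-algebra, for the basis (e_i) = vbasis {:V}.                               *)
Definition qleval (A : comNzRingType) (f : F -> A) (x : 'rV[A]_(\dim {:V})) : A :=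
  \sum_(i < \dim {:V}) f (phi (vbasis {:V})`_i) * x 0 i ^+ 2.

Lemma qlevalE (A : comNzRingType) (f : {rmorphism F -> A}) v :
  f (phi v) = qleval f (\row_i f (coord (vbasis {:V}) i v)).
Proof.
rewrite [in LHS](coord_vbasis (memvf v)) /qleval.
rewrite (big_morph (fun v => f (phi v)) (id1 := 0) (op1 := +%R)) /=; last 2 first.
- by move=> v1 v2; rewrite qlformD rmorphD.
- by rewrite qlform0 rmorph0.
by apply: eq_bigr => i _; rewrite qlformZ rmorphM rmorphXn mxE mulrC.
Qed.

(* phi as a homogeneous quadratic polynomial: its value at the generic vector. *)
Definition qlpoly : {mpoly F[\dim {:V}]} :=
  qleval (@mpolyC _ F) (\row_i 'X_i).

Variables (L : fieldType) (iota : {rmorphism F -> L}).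

Lemma qleval_char2 v : iota (phi v) *+ 2 = 0.
Proof.
have := qlformD phi v v; rewrite -mulr2n -scaler_nat qlformZ -mulr2n.
rewrite -natrX mulr_natl => /eqP; rewrite -subr_eq0 -mulrnBr // => /eqP.
by rewrite -rmorphMn => ->; rewrite rmorph0.
Qed.

Lemma qlevalD x y : qleval iota (x + y) = qleval iota x + qleval iota y.
Proof.
rewrite /qleval -big_split; apply: eq_bigr => i _ /=.
rewrite mxE sqrrD mulrDr mulrDr mulrnAr -mulrnAl.
by rewrite qleval_char2 mul0r addr0.
Qed.

Lemma qleval_quadratic : quadratic (qleval iota).
Proof.
split=> [a x|w].
  rewrite /qleval mulr_sumr; apply: eq_bigr => i _.
  by rewrite mxE exprMn mulrCA.
have polar0 v : polar (qleval iota) v w = 0.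
  by rewrite /polar qlevalD -addrA -opprD subrr.
by move=> a u v; rewrite !polar0 mulr0 addr0.
Qed.

(* phi_L, on the space L (x) V identified with L^dim(V) by the same basis. *)
Definition qlform_ext : qlform 'rV[L]_(\dim {:V}) :=
  QLForm qleval_quadratic qlevalD.

End BaseChange.

(* (K, iota) is a function field of the quadric X_phi in P(V), that is, the    *)
(* residue field at its generic point: x collects the images in K of           *)
(* homogeneous coordinates at that point, a form vanishes at x exactly when it *)
(* lies in the ideal (phi) of X_phi, and every element of K is the value at x  *)
(* of a quotient of two forms of equal degree. This determines K up to         *)
(* F-isomorphism.                                                              *)
Definition is_function_field (F : fieldType) (V : vectType F) (phi : qlform V)
    (K : fieldType) (iota : {rmorphism F -> K}) : Prop :=
  exists x : 'I_(\dim {:V}) -> K,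
    (forall (d : nat) (p : {mpoly F[\dim {:V}]}), p \is d.-homog ->
       (mmap iota x p = 0 <-> exists g, p = g * qlpoly phi)) /\
    (forall z : K, exists (d : nat) (p q : {mpoly F[\dim {:V}]}),
       [/\ p \is d.-homog, q \is d.-homog, mmap iota x q != 0
         & z = mmap iota x p / mmap iota x q]).

(* Existence of the function field for anisotropic phi of dimension > 1: the   *)
(* ideal (phi) is prime (X_phi is integral).                                   *)
Module FunctionFieldExistence.

Section Kernel.
Variables (F : fieldType) (charF : 2%N \in [pchar F]) (n : nat) (a : 'I_n -> F).
Variables (i0 i1 : 'I_n) (i01 : i1 != i0).
Hypothesis aniso : forall c : 'I_n -> F, \sum_i a i * c i ^+ 2 = 0 -> forall i, c i = 0.
Local Notation M := {mpoly F[n]}.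
Definition P : M := \sum_i (a i)%:MP * 'X_i ^+ 2.
Definition s : M := \sum_(i | i != i0) (a i / a i0)%:MP * 'X_i ^+ 2.
Definition h i : M := if i == i0 then s else 'X_i ^+ 2.
Definition frob : {rmorphism F -> M} := GRing.RMorphism.clone _ _ (@mpolyC n F \o pFrobenius_aut charF) _.
(* N is the ring morphism with N f = f^2 mod P and N f free of X_i0; its       *)
(* kernel is the ideal (P), which is therefore prime.                          *)
Definition N : {rmorphism M -> M} := GRing.RMorphism.clone _ _ (mmap frob h) _.

Lemma charM : 2%N \in [pchar M].
Proof. by rewrite (rmorph_pchar (@mpolyC n F)). Qed.

Lemma a_neq0 i : a i != 0.
Proof.
apply/eqP => ai0; have := aniso (c := fun j => (j == i)%:R).
rewrite (bigD1 i) //= ai0 mul0r add0r big1 => [|j /negPf ->]; last by rewrite expr0n mulr0.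
by move=> /(_ erefl i) /eqP; rewrite eqxx oner_eq0.
Qed.

Lemma NC c : N c%:MP = c%:MP ^+ 2.
Proof. by rewrite /N /= mmapC /= pFrobenius_autE rmorphXn. Qed.
Lemma NX i : N 'X_i = h i.
Proof. by rewrite /N /= mmapX mmap1U. Qed.

Lemma PE : P = (a i0)%:MP * ('X_i0 ^+ 2 + s).
Proof.
rewrite /P (bigD1 i0) //= mulrDr; congr (_ + _).
rewrite /s mulr_sumr; apply: eq_bigr => i _.
by rewrite mulrA -mpolyCM [a i0 * _]mulrC divfK // a_neq0.
Qed.

Lemma sqrM (x y : M) : (x + y) ^+ 2 = x ^+ 2 + y ^+ 2.
Proof. by rewrite -!(pFrobenius_autE charM) rmorphD. Qed.

(* The polynomials not involving X_i0. *)
Inductive B : M -> Prop :=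
| BC c : B c%:MP | BX i : i != i0 -> B 'X_i
| BD u v : B u -> B v -> B (u + v) | BM u v : B u -> B v -> B (u * v).

Lemma NB u : B u -> N u = u ^+ 2.
Proof.
elim=> [c|i ne|v w _ Hv _ Hw|v w _ Hv _ Hw]; first exact: NC.
- by rewrite NX /h (negPf ne).
- by rewrite rmorphD Hv Hw sqrM.
- by rewrite rmorphM Hv Hw exprMn.
Qed.

Lemma Bs : B s.
Proof.
rewrite /s; elim/big_rec: _ => [|i x ne Hx]; first by rewrite -(mpolyC0 n); exact: BC.
by apply: BD => //; apply: BM; [exact: BC | rewrite expr2; apply: BM; exact: BX].
Qed.

Lemma NP : N P = 0.
Proof.
rewrite PE rmorphM rmorphD rmorphXn NX /h eqxx (NB Bs).
by rewrite -mulr2n (mulrn_pchar charM) mulr0.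
Qed.

(* Every polynomial has a remainder mod P of degree at most 1 in X_i0. *)
Definition D f := exists g u v, [/\ B u, B v & f = g * P + u + v * 'X_i0].

Lemma B0 : B 0. Proof. by rewrite -(mpolyC0 n); exact: BC. Qed.

Lemma DD f1 f2 : D f1 -> D f2 -> D (f1 + f2).
Proof.
move=> [g1 [u1 [v1 [? ? ->]]]] [g2 [u2 [v2 [? ? ->]]]].
exists (g1 + g2), (u1 + u2), (v1 + v2); split; try exact: BD.
by rewrite !mulrDl addrACA; congr (_ + _); rewrite addrACA.
Qed.
Lemma DB b f : B b -> D f -> D (b * f).
Proof.
move=> Bb [g [u [v [? ? ->]]]].
exists (b * g), (b * u), (b * v); split; try exact: BM.
by rewrite !mulrDr !mulrA.
Qed.
Lemma DX i f : D f -> D ('X_i * f).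
Proof.
have [-> |ne] := eqVneq i i0; last by apply: DB; exact: BX.
move=> [g [u [v [Bu Bv ->]]]].
exists (g * 'X_i0 + v * (a i0)^-1%:MP), (v * ((-1)%:MP * s)), u; split => //.
  by apply: BM => //; apply: BM; [exact: BC | exact: Bs].
have : (a i0)^-1%:MP * P = 'X_i0 ^+ 2 + s.
  by rewrite PE mulrA -mpolyCM mulVf ?a_neq0 // mul1r.
rewrite mpolyCN mpolyC1; move: P s ((a i0)^-1%:MP) => p t c E.
have -> : (g * 'X_i0 + v * c) * p = g * 'X_i0 * p + v * (c * p) by ring.
rewrite E; ring.
Qed.

Lemma DA f : D f.
Proof.
rewrite [f]mpolyE; elim/big_rec: _ => [|m x _ Dx].
  exists 0, 0, 0; split; try exact: B0.
  by rewrite !mul0r !addr0.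
apply: DD => //; rewrite -mul_mpolyC; apply: DB; first exact: BC.
rewrite mpolyXE_id; elim/big_rec: _ => [|i y _ Dy].
  exists 0, 1, 0; split; [rewrite -(mpolyC1 n); exact: BC | exact: B0 |].
  by rewrite !mul0r add0r addr0.
elim: (m i) => [|k IH]; first by rewrite expr0 mul1r.
by rewrite exprS -mulrA; apply: DX.
Qed.

Lemma s_coef m : s@_m != 0 -> exists2 i, i != i0 & s@_m = a i / a i0.
Proof.
rewrite /s linear_sum /=.
have cE i : ((a i / a i0)%:MP * 'X_i ^+ 2 : M)@_m = (a i / a i0) * ((U_(i) *+ 2)%MM == m)%:R.
  by rewrite mcoeffCM mpolyXn mcoeffX.
rewrite (eq_bigr _ (fun i _ => cE i)).
have [/existsP[i /andP[ne /eqP e]] _|] := boolP [exists i, (i != i0) && ((U_(i) *+ 2)%MM == m)].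
  exists i => //; rewrite (bigD1 i) //= e eqxx mulr1 big1 ?addr0 // => j /andP[_ ji].
  case: eqP => [|_]; last by rewrite mulr0.
  rewrite -e => /mnmP /(_ i); rewrite !mulmnE !mnm1E eqxx (negPf ji).
  by [].
rewrite negb_exists => /forallP H; rewrite big1 ?eqxx // => i ne.
by have := H i; rewrite ne /= => /negPf ->; rewrite mulr0.
Qed.

Lemma s_neq0 : s != 0.
Proof.
apply/eqP => /(congr1 (meval (fun j => (j == i1)%:R))); rewrite /s raddf_sum /= raddf0.
rewrite (bigD1 i1) //= big1 => [|j /andP[_ /negPf ne]]; last first.
  by rewrite mevalM mevalC rmorphXn /= mevalXU ne expr0n mulr0.
rewrite mevalM mevalC rmorphXn /= mevalXU eqxx expr1n mulr1 addr0 => /eqP.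
by rewrite mulf_eq0 invr_eq0 !(negPf (a_neq0 _)).
Qed.

Lemma kerN f : N f = 0 <-> exists g, f = g * P.
Proof.
split=> [|[g ->]]; last by rewrite rmorphM NP mulr0.
have [g [u [v [Bu Bv ->]]]] := DA f.
rewrite !rmorphD !rmorphM NP mulr0 add0r NX /h eqxx (NB Bu) (NB Bv) => E.
have [v0|v0] := eqVneq v 0.
  move: E; rewrite v0 expr0n mul0r addr0 => /eqP; rewrite sqrf_eq0 => /eqP ->.
  by exists g; rewrite mul0r !addr0.
have {}E : v ^+ 2 * s = u ^+ 2.
  by apply/eqP; rewrite -subr_eq0 (oppr_pchar2 charM) addrC E.
have sl : mleadc s != 0 by rewrite mleadc_eq0 s_neq0.
have [i ne si] := s_coef sl.
have w0 : mleadc v != 0 by rewrite mleadc_eq0.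
have lE (p q : M) : mleadc (p * q) = mleadc p * mleadc q.
  have [->|p0] := eqVneq p 0; first by rewrite mul0r mleadc0 mul0r.
  have [->|q0] := eqVneq q 0; first by rewrite mulr0 mleadc0 mulr0.
  by rewrite mleadM // mleadcM.
have := congr1 (fun p => mleadc p) E; rewrite /= !expr2 !lE si => E2.
case/eqP: w0; have /(_ _ i) := aniso (c := fun j => if j == i then mleadc v else if j == i0 then mleadc u else 0).
have ne' : (i0 == i) = false by rewrite eq_sym (negPf ne).
rewrite eqxx; apply; rewrite (bigD1 i) //= eqxx (bigD1 i0) ?ne' //= eqxx.
rewrite big1 => [|j /andP[/negPf -> /negPf ->]]; last by rewrite expr0n mulr0.
rewrite addr0 !expr2 -E2.
have E3 : a i0 * (mleadc v * mleadc v * (a i / a i0)) = a i * (mleadc v * mleadc v).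
  by field; exact: a_neq0.
by rewrite E3 -mulr2n (mulrn_pchar charF).
Qed.
End Kernel.

(* The subfield of E of the values at y of quotients of forms of equal degree. *)
Section Sub.
Variables (F E : fieldType) (n : nat) (iota : {rmorphism F -> E}) (y : 'I_n -> E).
Local Notation ev := (mmap iota y).
Definition isfrac (z : E) : Prop := exists (d : nat) (p q : {mpoly F[n]}),
  [/\ p \is d.-homog, q \is d.-homog, ev q != 0 & z = ev p / ev q].
Definition fracP (z : E) : bool := if excluded_middle_informative (isfrac z) then true else false.
Lemma fracPP z : reflect (isfrac z) (fracP z).
Proof. by rewrite /fracP; case: excluded_middle_informative => H; constructor. Qed.
Lemma frac_closed : divring_closed fracP.
Proof.
split.
- apply/fracPP; exists 0%N, 1, 1; rewrite rmorph1 oner_neq0 divr1.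
  by split => //; exact: dhomog1.
- move=> _ _ /fracPP[d1 [p1 [q1 [hp1 hq1 n1 ->]]]] /fracPP[d2 [p2 [q2 [hp2 hq2 n2 ->]]]].
  apply/fracPP; exists (d1 + d2)%N, (p1 * q2 - p2 * q1), (q1 * q2); split.
  + apply: rpredB; first exact: dhomogM.
    by rewrite addnC; exact: dhomogM.
  + exact: dhomogM.
  + by rewrite rmorphM mulf_neq0.
  + by rewrite rmorphB !rmorphM; field; rewrite n1 n2.
- move=> _ _ /fracPP[d1 [p1 [q1 [hp1 hq1 n1 ->]]]] /fracPP[d2 [p2 [q2 [hp2 hq2 n2 ->]]]].
  apply/fracPP; have [p20|p20] := eqVneq (ev p2) 0.
    exists 0%N, 0, 1; rewrite p20 rmorph1 rmorph0 oner_neq0 !mul0r invr0 mulr0.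
    by split => //; [exact: rpred0 | exact: dhomog1].
  exists (d1 + d2)%N, (p1 * q2), (q1 * p2); split.
  + exact: dhomogM.
  + exact: dhomogM.
  + by rewrite rmorphM mulf_neq0.
  + by rewrite !rmorphM; field; rewrite n1 n2 p20.
Qed.
HB.instance Definition _ := GRing.isDivringClosed.Build E fracP frac_closed.
Definition K := {z : E | fracP z}.
HB.instance Definition _ := SubType.on K.
HB.instance Definition _ := Choice.on K.
HB.instance Definition _ := [SubChoice_isSubIntegralDomain of K by <:].
HB.instance Definition _ := [SubIntegralDomain_isSubField of K by <:].

Lemma iota_frac c : fracP (iota c).
Proof.
apply/fracPP; exists 0%N, c%:MP, 1; rewrite rmorph1 oner_neq0 divr1 mmapC.
split => //; last exact: dhomog1.
by rewrite -alg_mpolyC; apply: rpredZ; exact: dhomog1.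
Qed.
Definition iotaK c : K := Sub (iota c) (iota_frac c).
Lemma iotaK_zmod : zmod_morphism iotaK.
Proof. by move=> u v; apply: val_inj; rewrite rmorphB /= rmorphB. Qed.
Lemma iotaK_mon : monoid_morphism iotaK.
Proof. by split=> [|u v]; apply: val_inj; rewrite ?rmorph1 ?rmorphM /= ?rmorph1 ?rmorphM. Qed.
HB.instance Definition _ := GRing.isZmodMorphism.Build F K iotaK iotaK_zmod.
HB.instance Definition _ := GRing.isMonoidMorphism.Build F K iotaK iotaK_mon.
Variables (yK : 'I_n -> K) (yKE : forall i, val (yK i) = y i).
Lemma val_mmap p : val (mmap iotaK yK p) = ev p.
Proof.
rewrite /mmap rmorph_sum; apply: eq_bigr => m _.
rewrite rmorphM; congr (_ * _); rewrite /mmap1 rmorph_prod.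
by apply: eq_bigr => i _; rewrite rmorphXn; congr (_ ^+ _); exact: yKE.
Qed.
End Sub.

Lemma function_field_exists (F : fieldType) (charF : 2%N \in [pchar F])
    (V : vectType F) (phi : qlform V) :
  anisotropic phi -> (1 < \dim {:V})%N ->
  exists (K : fieldType) (iota : {rmorphism F -> K}), is_function_field phi iota.
Proof.
move=> an dim1; set n := \dim {:V} in dim1 *.
pose a (i : 'I_n) := phi (vbasis {:V})`_i.
have aniso (c : 'I_n -> F) : \sum_i a i * c i ^+ 2 = 0 -> forall i, c i = 0.
  move=> c0.
  pose v := \sum_i c i *: (vbasis {:V})`_i.
  have vc i : coord (vbasis {:V}) i v = c i.
    by rewrite coord_sum_free // (basis_free (vbasisP _)).
  have v0 : phi v = 0.
    rewrite -[LHS]/(idfun (phi v)) qlevalE -[RHS]c0; apply: eq_bigr => i _.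
    by rewrite mxE vc.
  have [vz i|vz] := eqVneq v 0; first by rewrite -vc vz linear0.
  by case: an; exists v.
pose i0 : 'I_n := Ordinal (ltnW dim1); pose i1 : 'I_n := Ordinal dim1.
have i01 : i1 != i0 by [].
pose Ef := {fraction {mpoly F[n]}}.
pose iE : {rmorphism F -> Ef} := GRing.RMorphism.clone _ _ (@FracField.tofrac _ \o @frob F charF n) _.
pose t i := @FracField.tofrac {mpoly F[n]} (h a i0 i).
pose y i : Ef := t i / t i0.
have s0 : t i0 != 0 by rewrite tofrac_eq0 /h eqxx (s_neq0 i01 aniso).
have evE d p : p \is d.-homog -> mmap iE y p = FracField.tofrac (N charF a i0 p) / t i0 ^+ d.
  move=> hp; rewrite /N /= /mmap rmorph_sum /= mulr_suml [LHS]big_seq [RHS]big_seq; apply: eq_bigr => m mp.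
  rewrite (rmorphM (@FracField.tofrac {mpoly F[n]}) _ (mmap1 _ m)) -[RHS]mulrA; congr (_ * _).
  rewrite /mmap1 (rmorph_prod (@FracField.tofrac {mpoly F[n]})).
  rewrite (eq_bigr (fun i => t i ^+ m i / t i0 ^+ m i)) => [|i _]; last exact: expr_div_n.
  rewrite big_split /=; congr (_ * _); first by apply: eq_bigr => i _; rewrite rmorphXn.
  by rewrite prodfV prodrXr -mdegE (dhomog_mf hp mp).
have yP i : fracP iE y (y i).
  apply/fracPP; exists 1%N, 'X_i, 'X_i0; rewrite !mmapX !mmap1U; split; try by rewrite dhomogX /= mdeg1.
    by rewrite /y divff ?oner_neq0.
  by rewrite /y divff // divr1.
pose yK i : K iE y := Sub (y i) (yP i).
exists (K iE y), (iotaK iE y), yK; split => [d p hp|z].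
  have PE' : qlpoly phi = P a by apply: eq_bigr => i _; rewrite mxE.
  rewrite PE' -(kerN charF i01 aniso p); split=> [/(congr1 val)|Np0]; last first.
    by apply: val_inj; rewrite (@val_mmap _ _ _ iE y yK) //= (evE d) // Np0 tofrac0 mul0r.
  rewrite (@val_mmap _ _ _ iE y yK) //= (evE d) // => /eqP.
  by rewrite mulf_eq0 invr_eq0 expf_eq0 (negPf s0) andbF orbF tofrac_eq0 => /eqP.
have /fracPP[d [p [q [hp hq q0 zE]]]] := valP z.
exists d, p, q; split => //.
  by rewrite -(inj_eq val_inj) (@val_mmap _ _ _ iE y yK).
by apply: val_inj; rewrite zE fmorph_div /= !(@val_mmap _ _ _ iE y yK).
Qed.

End FunctionFieldExistence.

(* Main.v *)
(* Let N = dim phi, r = i_1(phi), and let phi be given by sum_j a_j X_j^2. It is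
   enough to find s with r <= 2^s and 2^s | N - r; the rest is arithmetic.

   Adjoin the roots w_j = sqrt(a_j) to K = F(phi), and let W be the K-span of
   the w_j, so that dim_K W = N - r. Over these roots phi is the square of the
   linear form l = sum_j w_j X_j. An isotropic vector of phi over K is, up to
   a scalar, the class of polynomials p_j with sum_j w_j p_j = h l for some
   polynomial h. Differentiating in the direction X_i and reducing modulo l
   gives h w_i = sum_j w_j (d_i p_j), which lies in W. Hence h W is contained in
   W, and the assignment (p_j) |-> h is K-linear and injective. The values h
   therefore generate a field k, of degree 2^s >= r over K as h^2 is in K, over
   which W is a vector space; so 2^s divides dim_K W = N - r. *)

From HB Require Import structures.
From Stdlib Require Import Classical.
Require Import Defs.
From mathcomp Require Import all_boot all_order all_algebra all_field.
From mathcomp Require Import mpoly ring zify.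

Set Implicit Arguments.
Unset Strict Implicit.
Unset Printing Implicit Defensive.

Import GRing.Theory.
Local Open Scope ring_scope.

Import FunctionFieldExistence.

(** * Squares in characteristic 2 and adjunction of square roots *)

Lemma sqr_pchar2_inj (R : idomainType) (charR : 2%N \in [pchar R]) (x y : R) :
  x ^+ 2 = y ^+ 2 -> x = y.
Proof.
move=> xy; apply/eqP; rewrite -subr_eq0 -sqrf_eq0 -(pFrobenius_autE charR).
by rewrite rmorphB /= !pFrobenius_autE xy subrr.
Qed.

Lemma sqr_sum_pchar2 (R : comNzRingType) (charR : 2%N \in [pchar R])
    (I : Type) (r : seq I) (f : I -> R) :
  (\sum_(i <- r) f i) ^+ 2 = \sum_(i <- r) f i ^+ 2.
Proof. by rewrite -(pFrobenius_autE charR) rmorph_sum. Qed.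

Lemma exists_sqrt_ext (K : fieldType) (s : seq K) :
  exists L : fieldExtType K,
    forall a, a \in s -> exists w : L, w ^+ 2 = a%:A.
Proof.
elim: s => [|a s [L sqrtL]]; first by exists K^o.
pose p : {poly L} := 'X^2 - (a%:A)%:P.
have p3 : size p = 3 by exact: size_XnsubC.
have rootp (z : L) : root p z = (z ^+ 2 == a%:A).
  by rewrite /root !hornerE subr_eq0.
have [[z z2]|nr] := classic (exists z : L, z ^+ 2 == a%:A).
  exists L => b; rewrite inE => /predU1P[->|/sqrtL //]; exists z; exact/eqP.
have irr_p : irreducible_poly p.
  apply: cubic_irreducible; first by rewrite p3.
  by move=> z; rewrite rootp; apply/negP => z2; apply: nr; exists z.
have [L' _ [z z2 _]] := irredp_FAdjoin irr_p.
(* [baseFieldType L'] is the quadratic extension L' of L, regarded as an extension of K. *)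
exists (baseFieldType L') => b; rewrite inE => /predU1P[->|/sqrtL[w w2]].
  exists (z : L'); rewrite baseField_scaleE; apply/eqP.
  by move: z2; rewrite rmorphB /= map_polyXn map_polyC /root !hornerE subr_eq0.
exists (in_alg L' w : baseFieldType L'); rewrite baseField_scaleE -w2.
exact: esym (rmorphXn (in_alg L') 2 w).
Qed.

(** * Fields generated by square roots and spaces stable under them *)

Section SquareExtension.
Variables (K : fieldType) (L : fieldExtType K).

Lemma dim_adjoin_sqrt (k : {subfield L}) (t : L) (b : K) :
  t ^+ 2 = b%:A -> \dim <<k; t>> = \dim k \/ \dim <<k; t>> = (2 * \dim k)%N.
Proof.
move=> t2; rewrite dim_Fadjoin.
suff: (adjoin_degree k t <= 2)%N.
  (* [adjoin_degree] is by definition a successor, so the bound 2 leaves only degrees 1 and 2. *)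
  by rewrite /adjoin_degree; case: (_.-1) => [|[|]] //; [left; rewrite mul1n | right].
pose p : {poly L} := 'X^2 - (b%:A)%:P.
have p3 : size p = 3 by exact: size_XnsubC.
have dv : minPoly k t %| p.
  apply: minPoly_dvdp; last by rewrite /root !hornerE t2 subrr.
  by rewrite rpredB ?rpredX ?polyOverX // polyOverC rpredZ ?rpred1.
have := dvdp_leq _ dv; rewrite p3 size_minPoly ltnS; apply.
by rewrite -size_poly_eq0 p3.
Qed.

Lemma dim_adjoin_seq_sqrt (ts : seq L) :
  (forall t, t \in ts -> exists b : K, t ^+ 2 = b%:A) ->
  exists s, \dim <<1 & ts>> = (2 ^ s)%N.
Proof.
elim/last_ind: ts => [|ts t IH] sq_ts; first by exists 0%N; rewrite Fadjoin_nil dimv1.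
have [|s dim_s] := IH.
  by move=> u uts; apply: sq_ts; rewrite mem_rcons inE uts orbT.
have [|b tb] := sq_ts t; first by rewrite mem_rcons mem_head.
rewrite adjoin_rcons.
have [->|->] := dim_adjoin_sqrt <<1 & ts>>%AS tb; rewrite dim_s; first by exists s.
by exists s.+1; rewrite expnS.
Qed.

(** Elements of k(t) are polynomials in t over k, so stability under k and t gives stability under
    k(t). *)
Lemma prodv_adjoin_seq (ts : seq L) (W : {vspace L}) :
  (forall t, t \in ts -> forall u, u \in W -> t * u \in W) ->
  (<<1 & ts>> * W <= W)%VS.
Proof.
elim/last_ind: ts => [|ts t IH] stab; first by rewrite Fadjoin_nil prod1v.
have {IH} /prodvP kW : (<<1 & ts>> * W <= W)%VS.
  by apply: IH => u uts; apply: stab; rewrite mem_rcons inE uts orbT.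
have tW u : u \in W -> t * u \in W by apply: stab; rewrite mem_rcons mem_head.
rewrite adjoin_rcons; apply/prodvP => y u /(@Fadjoin_polyP _ _ <<1 & ts>>%AS t y) [p pk ->] uW.
rewrite horner_coef mulr_suml; apply: rpred_sum => i _.
rewrite -mulrA kW //; first exact: (polyOverP pk).
by elim: (nat_of_ord i) => [|j IHj]; rewrite ?expr0 ?mul1r // exprS -mulrA tW.
Qed.

(** The field generated by [ts] acts on W, so its degree, a power of 2, divides dim W; the free
    family [ts] lies in it and bounds that degree from below. *)
Lemma dvdn_dim_stable (ts : seq L) (W : {vspace L}) :
  (forall t, t \in ts -> exists b : K, t ^+ 2 = b%:A) ->
  (forall t, t \in ts -> forall u, u \in W -> t * u \in W) -> free ts ->
  exists2 s, (size ts <= 2 ^ s)%N & (2 ^ s %| \dim W)%N.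
Proof.
move=> sq_ts stab free_ts; have [s dim_s] := dim_adjoin_seq_sqrt sq_ts.
exists s; rewrite -dim_s.
  rewrite -(eqP free_ts) dimvS //; apply/span_subvP => t; exact: seqv_sub_adjoin.
exact: (@field_module_dimS _ _ <<1 & ts>>%AS) (prodv_adjoin_seq stab).
Qed.

End SquareExtension.

(** * Arithmetic of powers of 2 dividing 2^n + m - r *)

Lemma pow2_dvd_gap (n m r s : nat) :
  (1 <= m <= 2 ^ n)%N -> (r < 2 ^ n + m)%N -> (r <= 2 ^ s)%N ->
  (2 ^ s %| 2 ^ n + m - r)%N -> r = m \/ (2 * r <= m)%N.
Proof.
move=> m_range r_lt r_le dvd.
have [->|r_gt0] := posnP r; first by right.
(* 2^s <= 2^n + m - r, which is below 2^(n+1) because m <= 2^n and r > 0. *)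
have lt : (2 ^ s < 2 ^ n.+1)%N by have := dvdn_leq _ dvd; rewrite expnS; lia.
have dvd2n : (2 ^ s %| 2 ^ n)%N by rewrite dvdn_exp2l // -ltnS -(ltn_exp2l _ _ (ltnSn 1)).
(* If r < m, then r <= 2^s <= m - r; if m < r, then r <= 2^s <= r - m, impossible as m >= 1. *)
case: (ltngtP r m) => [r_m|m_r|]; last by left.
- have : (2 ^ s %| m - r)%N by rewrite -(dvdn_addr _ dvd2n) addnBA // ltnW.
  by move=> /dvdn_leq; lia.
- have : (2 ^ s %| r - m)%N.
    by rewrite -(dvdn_addr _ dvd) (_ : (_ + _ = 2 ^ n)%N) //; lia.
  by move=> /dvdn_leq; lia.
Qed.

(** * Formal directional derivatives of polynomials *)

Section Taylor.
Variables (F : fieldType) (n : nat).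
Local Notation M := {mpoly F[n]}.
Variable i : 'I_n.

(* p(X + eps e_i); [pder] is its coefficient of eps, and in characteristic 2
   that of eps^2 in the expansion of p^2 is [pder p ^+ 2]. *)
Definition taylor : {rmorphism M -> {poly M}} :=
  GRing.RMorphism.clone _ _
    (mmap (@polyC M \o @mpolyC n F) (fun k => ('X_k)%:P + (k == i)%:R * 'X)) _.

Definition pder (p : M) : M := (taylor p)`_1.

Lemma taylorC c : taylor c%:MP = (c%:MP)%:P.
Proof. by rewrite /taylor /= mmapC. Qed.

Lemma taylorX k : taylor 'X_k = ('X_k)%:P + (k == i)%:R * 'X.
Proof. by rewrite /taylor /= mmapX mmap1U. Qed.

Lemma taylor0 p : (taylor p)`_0 = p.
Proof.
rewrite -horner_coef0; elim/mpolyind: p => [|c m p _ _ IHp]; first by rewrite rmorph0 horner0.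
rewrite rmorphD hornerD; congr (_ + _); last exact: IHp.
rewrite -mul_mpolyC rmorphM hornerM taylorC hornerC; congr (_ * _).
rewrite mpolyXE_id rmorph_prod horner_prod; apply: eq_bigr => k _.
by rewrite rmorphXn /= horner_exp taylorX !hornerE.
Qed.

Lemma pder_sqr (charF : 2%N \in [pchar F]) p : (taylor (p ^+ 2))`_2 = pder p ^+ 2.
Proof.
have charM := charM charF n.
rewrite rmorphXn expr2 coefM !big_ord_recl big_ord0 /= /bump /= addr0 !add1n subn1 /=.
rewrite [X in _ + (_ + X)]mulrC addrCA -mulr2n (mulrn_pchar charM) addr0.
by rewrite /pder expr2.
Qed.

Section Form.
Variables (charF : 2%N \in [pchar F]) (a : 'I_n -> F).

(** Squaring is additive, so the shift of X_i leaves no term linear in eps. *)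
Lemma taylor_form : taylor (P a) = (P a)%:P + (a i)%:MP%:P * 'X^2.
Proof.
have charMX : 2%N \in [pchar {poly M}] by rewrite (rmorph_pchar (@polyC M)) // charM.
rewrite /P rmorph_sum /= (eq_bigr (fun k => ((a k)%:MP * 'X_k ^+ 2)%:P +
   (k == i)%:R * (a k)%:MP%:P * 'X^2)).
  rewrite big_split /= -rmorph_sum /=; congr (_ + _).
  by rewrite (bigD1 i) //= eqxx mul1r big1 ?addr0 // => k /negPf ->; rewrite !mul0r.
move=> k _; rewrite rmorphM taylorC rmorphXn /= taylorX.
rewrite -!(pFrobenius_autE charMX) rmorphD /= !pFrobenius_autE exprMn.
rewrite mulrDr rmorphM rmorphXn; congr (_ + _).
case: (k == i); first by rewrite expr1n !mul1r.
by rewrite expr0n !mul0r mulr0.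
Qed.

(** Compare the coefficients of eps^2 in both expansions; e is that of g. Modulo P this is the
    square of h w_i = sum_j w_j (d_i p_j). *)
Lemma form_pder (p : 'I_n -> M) g :
  \sum_j (a j)%:MP * p j ^+ 2 = g * P a ->
  exists e, \sum_j (a j)%:MP * pder (p j) ^+ 2 = g * (a i)%:MP + e * P a.
Proof.
move=> /(congr1 taylor) /(congr1 (fun q : {poly M} => q`_2)).
rewrite rmorph_sum coef_sum rmorphM taylor_form => E.
exists (taylor g)`_2; rewrite -[X in _ = X * _ + _](taylor0 g).
rewrite mulrDr coefD coefMC mulrA coefMXn coefMC /= in E.
rewrite addrC -E; apply: eq_bigr => j _.
by rewrite rmorphM taylorC coefCM pder_sqr.
Qed.

Lemma taylor_B u : B i u -> taylor u = u%:P.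
Proof.
elim=> [c|k /negPf ki|v w _ Hv _ Hw|v w _ Hv _ Hw]; first exact: taylorC.
- by rewrite taylorX ki mul0r addr0.
- by rewrite rmorphD polyCD Hv Hw.
- by rewrite rmorphM polyCM Hv Hw.
Qed.

(** P has no eps-term and the shift fixes u and v, so modulo P the derivative isolates v. *)
Lemma pder_decomposition g u v : B i u -> B i v ->
  pder (g * P a + u + v * 'X_i) = pder g * P a + v.
Proof.
move=> Bu Bv; rewrite /pder !rmorphD !rmorphM /= taylor_form (taylor_B Bu) (taylor_B Bv) taylorX.
rewrite eqxx mul1r !coefD mulrDr coefD coefMC mulrA coefMXn /= coefC /= !addr0.
by rewrite coefCM coefD coefC coefX add0r mulr1.
Qed.
End Form.
End Taylor.

(** * Anisotropy over polynomial rings *)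

Lemma mcoeff_sqr_double (F : fieldType) (charF : 2%N \in [pchar F]) n
    (p : {mpoly F[n]}) (m : 'X_{1..n}) : (p ^+ 2)@_(m *+ 2)%MM = p@_m ^+ 2.
Proof.
have charM := charM charF n.
elim/mpolyind: p => [|c k p _ _ IHp]; first by rewrite expr0n !mcoeff0 expr0n.
rewrite -(pFrobenius_autE charM) rmorphD /= !pFrobenius_autE !mcoeffD IHp.
rewrite -[RHS](pFrobenius_autE charF) rmorphD /= !pFrobenius_autE; congr (_ + _).
rewrite exprZn mpolyXn !mcoeffZ !mcoeffX exprMn; congr (_ * _).
have -> : ((k *+ 2)%MM == (m *+ 2)%MM) = (k == m).
  apply/eqP/eqP => [/mnmP E|->//]; apply/mnmP => l; have := E l.
  by rewrite !mulmnE => /eqP; rewrite eqn_mul2r => /eqP.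
by case: (k == m); rewrite ?expr1n // expr0n.
Qed.

Section Anisotropic.
Variables (F : fieldType) (charF : 2%N \in [pchar F]) (n : nat) (a : 'I_n -> F).
Variable i0 : 'I_n.
Hypothesis aniso : forall c : 'I_n -> F, \sum_i a i * c i ^+ 2 = 0 -> forall i, c i = 0.
Local Notation M := {mpoly F[n]}.

(** The coefficient of the relation at X^(2m) is the form over F evaluated at the coefficients of
    the p_j at X^m. *)
Lemma aniso_mpoly (p : 'I_n -> M) :
  \sum_j (a j)%:MP * p j ^+ 2 = 0 -> forall j, p j = 0.
Proof.
move=> E j; apply/mpolyP => m; rewrite mcoeff0.
apply: (aniso (c := fun j => (p j)@_m)); have := congr1 (mcoeff (m *+ 2)%MM) E.
rewrite mcoeff0 linear_sum /= => E'; rewrite -[RHS]E'; apply: eq_bigr => k _.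
by rewrite mcoeffCM mcoeff_sqr_double.
Qed.

(** [N] squares the left side, which is free of X_i0, and kills P; so the relation modulo P is an
    equality to 0. *)
Lemma aniso_B (p : 'I_n -> M) e : (forall j, B i0 (p j)) ->
  \sum_j (a j)%:MP * p j ^+ 2 = e * P a -> forall j, p j = 0.
Proof.
move=> Bp E; apply: aniso_mpoly; apply/eqP; rewrite -sqrf_eq0.
rewrite (sqr_sum_pchar2 (charM charF n)).
have <- : N charF a i0 (\sum_j (a j)%:MP * p j ^+ 2) = 
    \sum_j ((a j)%:MP * p j ^+ 2) ^+ 2.
  rewrite rmorph_sum; apply: eq_bigr => j _.
  by rewrite rmorphM rmorphXn NC /= (NB charF a (Bp j)) !exprMn -expr2.
by rewrite E rmorphM (NP charF i0 aniso) mulr0.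
Qed.

(* Writing C j = g P + u + v X_i0 with u, v free of X_i0, the eps^2-coefficient
   of the relation forces v = 0, and then the relation itself forces u = 0. *)
Lemma form_dvd_sqr (C : 'I_n -> M) g e :
  \sum_j (a j)%:MP * C j ^+ 2 = g * P a -> g = e * P a ->
  forall j, exists f, C j = f * P a.
Proof.
move=> E gE.
have /fin_all_exists [G /fin_all_exists [U /fin_all_exists [V GUV]]] j := DA i0 aniso (C j).
have sqrD (x y : M) : (x + y) ^+ 2 = x ^+ 2 + y ^+ 2.
  by rewrite -!(pFrobenius_autE (charM charF n)) rmorphD.
(* Multiples of P in the entries contribute only multiples of P^2. *)
have reduce (p q r : 'I_n -> M) h : (forall j, p j = q j * P a + r j) ->
  \sum_j (a j)%:MP * p j ^+ 2 = h * P a ->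
  \sum_j (a j)%:MP * r j ^+ 2 = (h - (\sum_j (a j)%:MP * q j ^+ 2) * P a) * P a.
  move=> pqr; rewrite mulrBl => <-; rewrite -mulrA -expr2 mulr_suml -sumrB.
  by apply: eq_bigr => j _; rewrite pqr sqrD exprMn; ring.
have V0 j : V j = 0.
  have [f fE] := form_pder i0 charF E.
  apply: aniso_B (reduce (fun j => pder i0 (C j)) (fun j => pder i0 (G j)) V
    (e * (a i0)%:MP + f) _ _) j.
  - by move=> j; case: (GUV j).
  - by move=> j; case: (GUV j) => BU BV ->; rewrite pder_decomposition.
  - by rewrite fE gE mulrDl mulrAC.
have CE j : C j = G j * P a + U j by case: (GUV j) => _ _ ->; rewrite V0 mul0r addr0.
have U0 j : U j = 0.
  by apply: aniso_B (reduce C G U g CE E) j => j; case: (GUV j).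
by move=> j; exists (G j); rewrite CE U0 addr0.
Qed.
End Anisotropic.

(** * Homogeneous cofactors and common denominators *)

Lemma dhomog_cofactor (F : fieldType) n (g p : {mpoly F[n]}) d e :
  p \is e.-homog -> g * p \is d.-homog ->
  exists2 g', g' \is (d - e).-homog & g * p = g' * p.
Proof.
(* Keep the monomials of g of degree d - e. Testing the sum mdeg m + e avoids truncated subtraction:
   for d < e nothing is kept. *)
move=> hp hgp; pose G d' m := if (mdeg m + e == d')%N then 'X_[m] else 0 : {mpoly F[n]}.
exists (\sum_(m <- msupp g) g@_m *: G d m).
  apply: rpred_sum => m _; apply: rpredZ; rewrite /G; case: eqP => [<-|_]; last exact: rpred0.
  by rewrite addnK dhomogX.
rewrite -[LHS](pihomog_dE hgp) {1}[g]mpolyE mulr_suml mulr_suml linear_sum /=.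
apply: eq_bigr => m _; rewrite -!scalerAl linearZ /=; congr (_ *: _).
have hXp : 'X_[m] * p \is (mdeg m + e).-homog by rewrite dhomogM // dhomogX.
rewrite /G; case: eqP => [<-|/eqP ne]; first exact: pihomog_dE.
by rewrite mul0r (pihomog_ne0 ne hXp).
Qed.

Section Fractions.
Variables (F K : fieldType) (n : nat) (iota : {rmorphism F -> K}) (x : 'I_n -> K).
Local Notation ev := (mmap iota x).

(** All numerators receive one degree, so that sums built from them are again forms. *)
Lemma common_denominator (I : finType) (z : I -> K) :
  (forall i, isfrac iota x (z i)) ->
  exists (d : nat) (q : {mpoly F[n]}) (p : I -> {mpoly F[n]}),
    [/\ q \is d.-homog, ev q != 0, forall i, p i \is d.-homog
      & forall i, ev (p i) = ev q * z i].
Proof.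
move=> fz.
have [d [q [hq q0 pq]]] : exists (d : nat) (q : {mpoly F[n]}),
    [/\ q \is d.-homog, ev q != 0
      & forall i, i \in enum I -> exists2 p, p \is d.-homog & ev p = ev q * z i].
  elim: (enum I) => [|i s [d [q [hq q0 pq]]]].
    by exists 0%N, 1; split; rewrite ?rmorph1 ?oner_neq0 // dhomog1.
  have [d' [p' [q' [hp' hq' q'0 zE]]]] := fz i.
  exists (d + d')%N, (q * q'); split; [exact: dhomogM | by rewrite rmorphM mulf_neq0 |].
  move=> j; rewrite inE => /predU1P[->|/pq [p hp pE]].
    by exists (q * p'); [exact: dhomogM | rewrite !rmorphM /= zE -mulrA [ev p' / _]mulrC mulVKf].
  by exists (p * q'); [exact: dhomogM | rewrite !rmorphM /= pE mulrAC].
have /fin_all_exists2 [p hp pE] i := pq i (mem_enum I i).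
by exists d, q, p.
Qed.
End Fractions.

(** * A quadratic form as the square of a linear form *)

Section LinearCombination.
Variables (K : fieldType) (L : fieldExtType K) (n : nat) (w : 'I_n -> L).

Definition lincomb (c : 'rV[K]_n) : L := \sum_j c 0 j *: w j.

Lemma lincomb_is_linear : linear lincomb.
Proof.
move=> k u v; rewrite /lincomb scaler_sumr -big_split; apply: eq_bigr => j _.
by rewrite !mxE scalerDl scalerA.
Qed.
HB.instance Definition _ :=
  GRing.isLinear.Build K 'rV[K]_n L _ lincomb lincomb_is_linear.

Variables (charK : 2%N \in [pchar K]) (b : 'I_n -> K).
Hypothesis w_sqr : forall j, w j ^+ 2 = (b j)%:A.

Lemma lincomb_sqr c : lincomb c ^+ 2 = (\sum_j b j * c 0 j ^+ 2)%:A.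
Proof.
have charL : 2%N \in [pchar L] by rewrite (rmorph_pchar (in_alg L)).
rewrite /lincomb (sqr_sum_pchar2 charL) scaler_suml; apply: eq_bigr => j _.
by rewrite exprZn w_sqr scalerA mulrC.
Qed.

Lemma lincomb_eq0 c : (lincomb c == 0) = (\sum_j b j * c 0 j ^+ 2 == 0).
Proof. by rewrite -sqrf_eq0 lincomb_sqr scaler_eq0 oner_eq0 orbF. Qed.
End LinearCombination.

(** * Multipliers attached to isotropic vectors over the function field *)

Section FunctionFieldPoint.
Variables (F : fieldType) (charF : 2%N \in [pchar F]) (n : nat) (a : 'I_n -> F).
Variable i0 : 'I_n.
Hypothesis aniso : forall c : 'I_n -> F, \sum_i a i * c i ^+ 2 = 0 -> forall i, c i = 0.
Variables (K : fieldType) (iota : {rmorphism F -> K}) (x : 'I_n -> K).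
Local Notation M := {mpoly F[n]}.
Local Notation ev := (mmap iota x).
Hypothesis ev_eq0 : forall d (p : M), p \is d.-homog ->
  (ev p = 0 <-> exists g, p = g * P a).
Hypothesis ev_frac : forall z, isfrac iota x z.
Variables (L : fieldExtType K) (w : 'I_n -> L).
Hypothesis w_sqr : forall j, w j ^+ 2 = (iota (a j))%:A.

Lemma P_homog : P a \is 2.-homog.
Proof.
apply: rpred_sum => j _; rewrite mul_mpolyC; apply: rpredZ.
by rewrite mpolyXn dhomogX /= mdegMn mdeg1.
Qed.

Lemma ev_P : ev (P a) = 0.
Proof. by apply/(ev_eq0 P_homog); exists 1; rewrite mul1r. Qed.

Let charK : 2%N \in [pchar K]. Proof. by rewrite (rmorph_pchar iota). Qed.
Let charL : 2%N \in [pchar L]. Proof. by rewrite (rmorph_pchar (in_alg L)). Qed.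

Lemma ev_form (p : 'I_n -> M) :
  ev (\sum_j (a j)%:MP * p j ^+ 2) = \sum_j iota (a j) * ev (p j) ^+ 2.
Proof.
rewrite rmorph_sum /=; apply: eq_bigr => j _.
by rewrite rmorphM rmorphXn /= mmapC.
Qed.

Lemma form_homog d (p : 'I_n -> M) : (forall j, p j \is d.-homog) ->
  \sum_j (a j)%:MP * p j ^+ 2 \is (d * 2).-homog.
Proof.
move=> hp; apply: rpred_sum => j _; rewrite mul_mpolyC; apply: rpredZ.
exact: dhomogMn.
Qed.

(* Over the square roots w of a, P a is the square of ell = \sum_j w j X_j, so
   [h] is the value of (\sum_j w j p j) / ell; multiplication by h sends w i to
   the derivative of \sum_j w j p j in the direction i. *)
Lemma exists_multiplier (p : 'I_n -> M) (g : M) :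
  \sum_j (a j)%:MP * p j ^+ 2 = g * P a ->
  exists2 h : L, h ^+ 2 = (ev g)%:A &
    forall i, h * w i = lincomb w (\row_j ev (pder i (p j))).
Proof.
move=> E; pose tau i := lincomb w (\row_j ev (pder i (p j))).
have tau2 i : tau i ^+ 2 = (ev g * iota (a i))%:A.
  rewrite (lincomb_sqr charK w_sqr); have [e /(congr1 ev)] := form_pder i charF E.
  rewrite ev_form rmorphD !rmorphM /= mmapC ev_P mulr0 addr0 => <-.
  by congr (_ *: _); apply: eq_bigr => j _; rewrite mxE.
have w0 : w i0 != 0.
  by rewrite -sqrf_eq0 w_sqr scaler_eq0 oner_eq0 orbF fmorph_eq0 (a_neq0 aniso).
have algM (y z : K) : (y * z)%:A = y%:A * z%:A :> L := rmorphM (in_alg L) y z.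
have h2 : (tau i0 / w i0) ^+ 2 = (ev g)%:A.
  by rewrite expr_div_n tau2 algM -w_sqr mulfK // sqrf_eq0.
(* The index i0 alone defines h; for the other i both sides have equal squares, and square roots are
   unique in characteristic 2. *)
exists (tau i0 / w i0) => // i; apply: (sqr_pchar2_inj charL).
by rewrite exprMn h2 w_sqr tau2 algM.
Qed.

Lemma exists_free_multipliers r (b : r.-tuple 'rV[K]_n) :
  (forall c, c \in b -> \sum_j iota (a j) * c 0 j ^+ 2 = 0) -> free b ->
  exists h : r.-tuple L, [/\ free h,
    forall t, t \in h -> exists g : K, t ^+ 2 = g%:A
  & forall t, t \in h -> forall i, exists c, t * w i = lincomb w c].
Proof.
move=> b_iso b_free.
have [d [q [p [hq q0 hp pE]]]] :=
  common_denominator (fun kj : 'I_r * 'I_n => ev_frac (tnth b kj.1 0 kj.2)).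
have /fin_all_exists2 [g hg gE] k : exists2 g : M, g \is (d * 2 - 2).-homog &
    \sum_j (a j)%:MP * p (k, j) ^+ 2 = g * P a.
  have hom : \sum_j (a j)%:MP * p (k, j) ^+ 2 \is (d * 2).-homog by exact: form_homog.
  have [|g gE] := (ev_eq0 hom).1.
    rewrite ev_form -[RHS](mulr0 (ev q ^+ 2)) -[X in _ = _ * X](b_iso _ (mem_tnth k b)).
    rewrite mulr_sumr.
    by apply: eq_bigr => j _; rewrite pE exprMn mulrCA.
  (* A homogeneous cofactor makes G below a form, so that its vanishing at x can be tested by
     [ev_eq0]. *)
  rewrite gE in hom *; have [g' hg' ->] := dhomog_cofactor P_homog hom.
  by exists g'.
have /fin_all_exists2 [h h2 hw] k := exists_multiplier (gE k).
exists (mktuple h); split; last 2 first.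
- by move=> _ /mapP[k _ ->]; exists (ev (g k)).
- by move=> _ /mapP[k _ ->] i; exists (\row_j ev (pder i (p (k, j)))).
apply/freeP => l l0.
have [d' [q' [m [hq' q'0 hm mE]]]] := common_denominator (fun k => ev_frac (l k)).
(* A relation among the multipliers, cleared of denominators, combines the vectors p (k, -) into C;
   G is the cofactor of C by additivity of squaring. *)
pose C j := \sum_k m k * p (k, j); pose G := \sum_k m k ^+ 2 * g k.
have CG : \sum_j (a j)%:MP * C j ^+ 2 = G * P a.
  rewrite /G mulr_suml; under eq_bigr do
    rewrite (sqr_sum_pchar2 (charM charF n)) mulr_sumr.
  rewrite exchange_big /=; apply: eq_bigr => k _; rewrite -mulrA -gE mulr_sumr.
  by apply: eq_bigr => j _; rewrite exprMn mulrCA.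
have hG : G \is (d' * 2 + (d * 2 - 2)).-homog.
  by apply: rpred_sum => k _; apply: dhomogM => //; apply: dhomogMn.
have [|e Ge] := (ev_eq0 hG).1.
  (* In L, ev G is the square of ev q' times sum_k l_k h_k, which is 0. *)
  have : (ev G)%:A = 0 :> L.
    rewrite rmorph_sum /= scaler_suml -[RHS](expr0n L 2) /= -[X in X ^+ 2](scaler0 _ (ev q')).
    rewrite -[X in _ *: X]l0 scaler_sumr (sqr_sum_pchar2 charL); apply: eq_bigr => k _.
    by rewrite nth_mktuple scalerA -mE exprZn h2 scalerA rmorphM rmorphXn.
  by move=> /eqP; rewrite scaler_eq0 oner_eq0 orbF => /eqP.
have hC j : C j \is (d' + d).-homog.
  by apply: rpred_sum => k _; apply: dhomogM.
(* C j is divisible by P, so its value at x, a nonzero multiple of sum_k l_k b_kj, vanishes. *)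
move/freeP: b_free; apply; apply/rowP => j; rewrite summxE mxE.
have /(ev_eq0 (hC j)) := form_dvd_sqr charF i0 aniso CG Ge j.
rewrite rmorph_sum /= => C0; apply: (mulfI (mulf_neq0 q'0 q0)); rewrite mulr0 -[RHS]C0.
rewrite mulr_sumr; apply: eq_bigr => k _.
by rewrite rmorphM /= pE mE mxE (tnth_nth 0) mulrACA.
Qed.
End FunctionFieldPoint.

(** * Coordinates on V and the dimension of the span of the square roots *)

Section Basis.
Variables (F : fieldType) (V : vectType F) (phi : qlform V).

Lemma anisotropic_coord (c : 'I_(\dim {:V}) -> F) : anisotropic phi ->
  \sum_(i < \dim {:V}) phi (vbasis {:V})`_i * c i ^+ 2 = 0 -> forall i, c i = 0.
Proof.
move=> an c0 i; pose v := \sum_i c i *: (vbasis {:V})`_i.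
have vc j : coord (vbasis {:V}) j v = c j.
  by rewrite coord_sum_free // (basis_free (vbasisP _)).
have v0 : phi v = 0.
  rewrite -[LHS]/(idfun (phi v)) qlevalE -[RHS]c0; apply: eq_bigr => j _.
  by rewrite mxE vc.
have [vz|vz] := eqVneq v 0; first by rewrite -vc vz linear0.
by case: an; exists v.
Qed.

Lemma qlpolyE : qlpoly phi = P (fun i : 'I_(\dim {:V}) => phi (vbasis {:V})`_i).
Proof. by apply: eq_bigr => i _; rewrite mxE. Qed.
End Basis.

Theorem defect_index_function_field_dvd (F : fieldType) (charF : 2%N \in [pchar F])
    (V : vectType F) (phi : qlform V) (K : fieldType) (iota : {rmorphism F -> K})
    (r := defect_index (qlform_ext phi iota)) :
  anisotropic phi -> (1 < \dim {:V})%N -> is_function_field phi iota ->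
  (r < \dim {:V})%N /\
  exists2 s, (r <= 2 ^ s)%N & (2 ^ s %| \dim {:V} - r)%N.
Proof.
move=> an dim1 [x [ev_eq0 ev_frac]].
pose a (i : 'I_(\dim {:V})) := phi (vbasis {:V})`_i.
pose i0 : 'I_(\dim {:V}) := Ordinal (ltnW dim1).
have aniso (c : 'I_(\dim {:V}) -> F) :
    \sum_i a i * c i ^+ 2 = 0 -> forall i, c i = 0 by exact: anisotropic_coord.
have charK : 2%N \in [pchar K] by rewrite (rmorph_pchar iota).
have [L sqrtL] := exists_sqrt_ext [seq iota (a i) | i : 'I_(\dim {:V})].
have /fin_all_exists [w w2] i := sqrtL _ (image_f (fun i => iota (a i)) (erefl : i \in predT)).
pose W := limg (linfun (lincomb w)).
have kerD : lker (linfun (lincomb w)) = defect_space (qlform_ext phi iota).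
  by apply/vspaceP => c; rewrite memv_ker lfunE mem_defect_space (lincomb_eq0 charK w2).
have dimW : (r + \dim W = \dim {:V})%N.
  have := limg_ker_dim (linfun (lincomb w)) fullv.
  rewrite capfv kerD => dimE; apply: etrans dimE _.
  by rewrite dimvf /dim /= mul1n.
(* A nonzero w_i0 in W makes dim W positive, which is r < dim phi. *)
have w0 : w i0 != 0.
  by rewrite -sqrf_eq0 w2 scaler_eq0 oner_eq0 orbF fmorph_eq0 (a_neq0 aniso).
have inW c : lincomb w c \in W by rewrite -lfunE memv_img ?memvf.
have wW i : w i \in W.
  suff <- : lincomb w (delta_mx 0 i) = w i by [].
  rewrite /lincomb (bigD1 i) //= mxE !eqxx scale1r big1 ?addr0 // => j /negPf ji.
  by rewrite mxE eqxx ji scale0r.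
have W_gt0 : (0 < \dim W)%N.
  rewrite lt0n dimv_eq0; apply: contra w0 => /eqP W0.
  by rewrite -memv0 -W0 wW.
split; first by rewrite -dimW -addn1 leq_add2l.
rewrite qlpolyE in ev_eq0.
have b_iso c : c \in vbasis (defect_space (qlform_ext phi iota)) ->
    \sum_j iota (a j) * c 0 j ^+ 2 = 0.
  by move=> /vbasis_mem; rewrite mem_defect_space => /eqP.
have [h [h_free h2 hw]] := exists_free_multipliers charF i0 aniso
  ev_eq0 ev_frac w2 b_iso (basis_free (vbasisP _)).
(* W is spanned by the w_i, so it suffices that t maps each of them into W. *)
have hW t : t \in h -> forall u, u \in W -> t * u \in W.
  move=> th _ /memv_imgP[c _ ->]; rewrite lfunE /= /lincomb mulr_sumr.
  apply: rpred_sum => i _; rewrite -scalerAr; apply: rpredZ.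
  by have [c' ->] := hw t th i.
have [s] := dvdn_dim_stable h2 hW h_free; rewrite size_tuple => hs dvd.
by exists s; rewrite // -dimW addKn.
Qed.

Theorem theorem9p4 (F : fieldType) (charF : 2%N \in [pchar F])
    (V : vectType F) (phi : qlform V)
    (aniso : anisotropic phi) (dim_gt1 : (1 < \dim {:V})%N)
    (n m : nat) (m_range : (1 <= m <= 2 ^ n)%N)
    (dim_phi : \dim {:V} = (2 ^ n + m)%N)
    (K : fieldType) (iota : {rmorphism F -> K})
    (functionK : is_function_field phi iota) :
  defect_index (qlform_ext phi iota) = m \/
  (2 * defect_index (qlform_ext phi iota) <= m)%N.
Proof.
have [r_lt [s r_le dvd]] := defect_index_function_field_dvd charF aniso dim_gt1 functionK.
move: (defect_index _) r_lt r_le dvd; rewrite dim_phi => r r_lt r_le dvd.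
exact: pow2_dvd_gap dvd.
Qed.
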